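(* Let $G$ be a baseline cdf and let $a,b,m,n>0$. Put $$\lambda_{p,q}=\binom{m+n-1}{p}\binom{m+n-1-p}{q}(-1)^q .$$ Then, for $t>0$, $$F^{BKwG}(t;a,b,m,n)=\sum_{p=m}^{m+n-1}\ \sum_{q=0}^{m+n-1-p}\lambda_{p,q}\left[F^{KwG}(t;a,b)\right]^{p+q}.$$
   Context: $G$ is the cdf of a baseline distribution with pdf $g(t)=\frac{d}{dt}G(t)$, $t>0$. $B(m,n)$ is the beta function and $I_x(m,n)=B(m,n)^{-1}\int_0^x v^{m-1}(1-v)^{n-1}\,dv$ is the incomplete beta function ratio. $\binom{\cdot}{\cdot}$ denotes the binomial coefficient. The Kumaraswamy-$G$ distribution $Kw\text{-}G(a,b)$ has cdf $F^{KwG}(t;a,b)=1-[1-G(t)^a]^b$. The Beta Kumaraswamy-$G$ ($BKw\text{-}G$) distribution with parameters $a,b,m,n>0$ has cdf $F^{BKwG}(t;a,b,m,n)=I_{1-[1-G(t)^a]^b}(m,n)$.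
   Formalization: The parameters m and n are taken to be positive integers, not arbitrary positive reals: for other values the sum from p=m to m+n-1 and its binomial coefficients are not defined or the identity fails (for m=n=1/2 the sum is empty). *)

(* Defs.v *)
From HB Require Import structures.
From mathcomp Require Import all_boot all_order all_algebra.
From mathcomp Require Import all_classical all_reals all_analysis.

Set Implicit Arguments.
Unset Strict Implicit.
Unset Printing Implicit Defensive.

Import Order.TTheory GRing.Theory Num.Theory.
Import numFieldNormedType.Exports.

Local Open Scope classical_set_scope.
Local Open Scope ring_scope.

(* [cdf X] of the library takes values in [\bar R]; it is always finite. *)
Definition real_cdf d (T : measurableType d) (R : realType)
  (P : probability T R) (X : {RV P >-> R}) (t : R) : R := fine (cdf X t).

Definition has_pdf d (T : measurableType d) (R : realType)
  (P : probability T R) (X : {RV P >-> R}) (g : R -> R) : Prop :=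
  [/\ measurable_fun [set: R] g,
      forall x, 0 <= g x &
      forall A : set R, measurable A ->
        distribution P X A = (\int[lebesgue_measure]_(x in A) (g x)%:E)%E].

(* The library's [beta_fun] only takes natural parameters. For parameters
   below 1, [powR] gives the singular factor the value 0 at its endpoint; this
   affects a null set only. *)
Definition beta_integral (R : realType) (x m n : R) : R :=
  \int[lebesgue_measure]_(v in `[0, x]) (v `^ (m - 1) * (1 - v) `^ (n - 1)).

Definition Beta (R : realType) (m n : R) : R := beta_integral 1 m n.

(* Meaningful for [0 <= x <= 1] only. *)
Definition inc_beta_ratio (R : realType) (x m n : R) : R :=
  (Beta m n)^-1 * beta_integral x m n.

Definition cdf_KwG (R : realType) (G : R -> R) (a b t : R) : R :=
  1 - (1 - G t `^ a) `^ b.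

Definition cdf_BKwG (R : realType) (G : R -> R) (a b m n t : R) : R :=
  inc_beta_ratio (1 - (1 - G t `^ a) `^ b) m n.

(* For [1 <= m], [1 <= n] and [p <= m + n - 1], the case in which it is used,
   no natural subtraction truncates. *)
Definition lambda_coef (R : realType) (m n p q : nat) : R :=
  'C(m + n - 1, p)%:R * 'C(m + n - 1 - p, q)%:R * (-1) ^+ q.

(* Main.v *)
Require Import Defs.
From HB Require Import structures.
From mathcomp Require Import all_boot all_order all_algebra.
From mathcomp Require Import all_classical all_reals all_analysis.
From mathcomp Require Import ring.

Set Implicit Arguments.
Unset Strict Implicit.
Unset Printing Implicit Defensive.

Import Order.TTheory GRing.Theory Num.Theory.
Import numFieldNormedType.Exports.

Local Open Scope classical_set_scope.
Local Open Scope ring_scope.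

(** Put [N = m + n - 1] and write [x] for the value of the Kumaraswamy-G cdf
    at [t], a point of the unit interval. Expanding [(1 - x) ^+ (N - p)] by the
    binomial theorem, the double sum is the upper tail
    [S x = \sum_(m <= p <= N) 'C(N, p) * x ^+ p * (1 - x) ^+ (N - p)]
    of the binomial distribution with [N] trials and success probability [x].
    The derivative of [S] telescopes ([deriv_binomial_tail]): only the term
    [m * 'C(N, m) * x ^+ (m - 1) * (1 - x) ^+ (n - 1)] survives, a constant
    multiple of the beta integrand. As [S 0 = 0], the fundamental theorem of
    calculus makes [S x] the same multiple of the incomplete beta integral
    ([binomial_tail_beta_integral]). The constant is then read off at [x = 1],
    where [S] equals [1]: it is the inverse of the complete beta integral, so
    the value of the beta function never has to be computed. *)

Definition binomial_tail (R : nzRingType) (N k : nat) : {poly R} :=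
  \sum_(k <= p < N.+1) 'C(N, p)%:R *: ('X^p * (1 - 'X) ^+ (N - p)).

(** The derivative of the summand of index [p] is [T p - T p.+1] with
    [T p = p * 'C(N, p) * 'X^(p - 1) * (1 - 'X) ^+ (N - p)], because
    [(N - p) * 'C(N, p) = p.+1 * 'C(N, p.+1)]; and [T N.+1 = 0]. *)
Lemma deriv_binomial_tail (R : comNzRingType) (N k : nat) : (k <= N)%N ->
  (binomial_tail R N k.+1)^`() =
  (k.+1 * 'C(N, k.+1))%:R *: ('X^k * (1 - 'X) ^+ (N - k.+1)).
Proof.
move=> kN; pose T p : {poly R} :=
  (p * 'C(N, p))%:R *: ('X^(p.-1) * (1 - 'X) ^+ (N - p)).
rewrite /binomial_tail raddf_sum /=.
rewrite (telescope_sumr_eq (fun p => - T p)) //; last first.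
  move=> p _; rewrite opprK derivZ derivM derivXn deriv_exp.
  have -> : (1 - 'X)^`() = - 1 :> {poly R}.
    by rewrite derivB -polyC1 derivC derivX sub0r.
  rewrite mulN1r.
  rewrite /T /= mul_bin_left subnS scalerDr [RHS]addrC; congr (_ + _).
    by rewrite mulrnAl -scaler_nat scalerA -natrM mulnC.
  by rewrite mulNrn mulrN scalerN mulrnAr -scaler_nat scalerA -natrM mulnC.
by rewrite {1}/T bin_small // muln0 scale0r oppr0 opprK add0r.
Qed.

Lemma horner_binomial_tail (R : comNzRingType) (N k : nat) (x : R) :
  (binomial_tail R N k).[x] =
  \sum_(k <= p < N.+1) 'C(N, p)%:R * (x ^+ p * (1 - x) ^+ (N - p)).
Proof.
by rewrite horner_sum; apply: eq_bigr => p _; rewrite !hornerE.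
Qed.

Lemma binomial_tail_at0 (R : comNzRingType) (N k : nat) :
  (binomial_tail R N k.+1).[0] = 0.
Proof.
rewrite horner_binomial_tail big_nat_cond big1 // => p /andP[/andP[kp _] _].
by rewrite expr0n; case: p kp => // p _; rewrite mul0r mulr0.
Qed.

Lemma binomial_tail_at1 (R : comNzRingType) (N k : nat) : (k <= N)%N ->
  (binomial_tail R N k).[1] = 1.
Proof.
move=> kN; rewrite horner_binomial_tail big_nat_recr //= subnn expr0 expr1n.
rewrite binn !mulr1 big_nat_cond big1 ?add0r // => p /andP[/andP[_ pN] _].
by rewrite subrr expr0n subn_eq0 leqNgt pN !mulr0.
Qed.

Lemma binomial_tail_lambda (R : realType) (m n : nat) (x : R) :
  (binomial_tail R (m + n - 1) m).[x] =
  \sum_(m <= p < (m + n - 1).+1) \sum_(0 <= q < (m + n - 1 - p).+1)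
    lambda_coef R m n p q * x ^+ (p + q).
Proof.
rewrite horner_binomial_tail; apply: eq_bigr => p _.
rewrite exprBn big_mkord !mulr_sumr; apply: eq_bigr => q _.
rewrite /lambda_coef expr1n mulr1 -mulr_natl exprD; ring.
Qed.

(** The real exponents [m - 1] and [n - 1] of the beta integral are natural
    numbers here, so on the unit interval its integrand is a polynomial, of
    which the tail polynomial is a primitive up to a constant factor. *)
Lemma binomial_tail_beta_integral (R : realType) (m n : nat) (x : R) :
  0 <= x <= 1 ->
  (binomial_tail R (m + n).+1 m.+1).[x] =
  (m.+1 * 'C((m + n).+1, m.+1))%:R * beta_integral x m.+1%:R n.+1%:R.
Proof.
move=> /andP[x0 x1]; set c : R := (_ * _)%:R.
have c_neq0 : c != 0.
  by rewrite pnatr_eq0 -lt0n muln_gt0 bin_gt0 /= ltnS leq_addr.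
pose S : {poly R} := c^-1 *: binomial_tail R (m + n).+1 m.+1.
have dS : S^`() = 'X^m * (1 - 'X) ^+ n.
  rewrite derivZ deriv_binomial_tail; last by rewrite ltnW // ltnS leq_addr.
  by rewrite scalerA mulVf // scale1r subSS addKn.
suff -> : beta_integral x m.+1%:R n.+1%:R = S.[x].
  by rewrite hornerZ mulrA divff // mul1r.
rewrite /beta_integral.
transitivity (\int[lebesgue_measure]_(v in `[0, x]) S^`().[v]).
  apply: eq_Rintegral => v; rewrite inE /= in_itv /= => /andP[v0 vx].
  rewrite dS !hornerE -!natr1 !addrK !powR_mulrn // subr_ge0.
  exact: le_trans vx x1.
(* The fundamental theorem of calculus asks for a nondegenerate interval. *)
move: x0; rewrite le_eqVlt => /predU1P[<-|x0].
  by rewrite set_itv1 Rintegral_set1 hornerZ binomial_tail_at0 mulr0.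
rewrite /Rintegral (@continuous_FTC2 _ _ (horner S)) //.
- by rewrite /= [S.[0]]hornerZ binomial_tail_at0 mulr0 subr0.
- by apply: continuous_subspaceT => v; exact: continuous_horner.
- split=> [v _||]; first exact: derivable_horner.
    by apply: cvg_at_right_filter; exact: continuous_horner.
  by apply: cvg_at_left_filter; exact: continuous_horner.
- by move=> v _; rewrite derivE.
Qed.

Lemma inc_beta_ratio_binomial_tail (R : realType) (m n : nat) (x : R) :
  (0 < m)%N -> (0 < n)%N -> 0 <= x <= 1 ->
  inc_beta_ratio x m%:R n%:R = (binomial_tail R (m + n - 1) m).[x].
Proof.
case: m n => // m [//|n] _ _ x01; rewrite addSn addnS subn1 /=.
have tail1 : 1 = (m.+1 * 'C((m + n).+1, m.+1))%:R * Beta m.+1%:R n.+1%:R :> R.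
  rewrite -binomial_tail_beta_integral ?ler01 ?lexx //.
  by rewrite binomial_tail_at1 // ltnS leq_addr.
have Beta_neq0 : Beta m.+1%:R n.+1%:R != 0 :> R.
  by apply: contra_eq_neq tail1 => ->; rewrite mulr0 oner_eq0.
rewrite binomial_tail_beta_integral // /inc_beta_ratio; congr (_ * _).
by apply: (mulIf Beta_neq0); rewrite mulVf.
Qed.

Lemma powR_itv01 (R : realType) (u r : R) :
  0 <= r -> 0 <= u <= 1 -> 0 <= u `^ r <= 1.
Proof.
move=> r0 /andP[u0 u1]; rewrite powR_ge0 /=.
have -> : 1 = 1 `^ r :> R by rewrite powR1.
by apply: ge0_ler_powR; rewrite ?nnegrE.
Qed.

Lemma onem_itv01 (R : realDomainType) (u : R) : 0 <= u <= 1 -> 0 <= 1 - u <= 1.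
Proof. by move=> /andP[u0 u1]; rewrite subr_ge0 u1 gerBl. Qed.

Lemma real_cdf_itv01 (d : measure_display) (T : measurableType d)
    (R : realType) (P : probability T R) (X : {RV P >-> R}) (t : R) :
  0 <= real_cdf X t <= 1.
Proof.
rewrite /real_cdf; have := cdf_ge0 X t; have := cdf_le1 X t.
by case: (cdf X t) => [r||] //=; rewrite !lee_fin => -> ->.
Qed.

Lemma cdf_KwG_itv01 (R : realType) (G : R -> R) (a b t : R) :
  0 <= a -> 0 <= b -> 0 <= G t <= 1 -> 0 <= cdf_KwG G a b t <= 1.
Proof.
move=> a0 b0 G01; apply/onem_itv01/powR_itv01 => //.
exact/onem_itv01/powR_itv01.
Qed.

Theorem mainTheorem4 (R : realType) (d : measure_display)
    (T : measurableType d) (P : probability T R) (X : {RV P >-> R})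
    (G g : R -> R)
    (hG : forall t, G t = real_cdf X t)
    (hpdf : has_pdf X g)
    (hder : {ae lebesgue_measure, forall t : R,
               0 < t -> is_derive t (1 : R) G (g t)})
    (a b : R) (m n : nat) (ha : 0 < a) (hb : 0 < b)
    (hm : (0 < m)%N) (hn : (0 < n)%N) (t : R) (ht : 0 < t) :
  cdf_BKwG G a b m%:R n%:R t =
  \sum_(m <= p < (m + n - 1).+1) \sum_(0 <= q < (m + n - 1 - p).+1)
    lambda_coef R m n p q * cdf_KwG G a b t ^+ (p + q).
Proof.
rewrite -binomial_tail_lambda -inc_beta_ratio_binomial_tail //.
apply: cdf_KwG_itv01; [exact: ltW..|].
by rewrite hG; exact: real_cdf_itv01.
Qed.
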